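(* Let $A$ be a finite non-empty alphabet. Relative to the standard Bernoulli measure on $A^\omega$, almost all words $x\in A^\omega$ with $\mathrm{card}(\mathrm{alph}\,x)>1$ belong to $\mathcal P_2$; that is, the set of all $x\in A^\omega$ with $\mathrm{card}(\mathrm{alph}\,x)>1$ and $x\notin\mathcal P_2$ has measure zero.
   Context: $A^\omega$ is the set of one-sided infinite words $x=x_1x_2\cdots$ with $x_i\in A$; $\mathrm{alph}\,x$ is the set of letters occurring in $x$; $\mathrm{Fact}^+x$ is the set of non-empty finite factors (contiguous blocks) of $x$. A factorization of $x$ is an expression $x=U_1U_2U_3\cdots$ with all $U_i$ non-empty finite words. For $k\ge 2$, $\mathcal P_k$ is the class of infinite words $x$ over finite alphabets for which there is a map (coloring) $c:\mathrm{Fact}^+x\to C$ with $\mathrm{card}(C)=k$ such that for each factorization $x=U_1U_2U_3\cdots$ there exist $i,j\ge1$ with $c(U_i)\ne c(U_j)$. The standard Bernoulli measure on $A^\omega$ is the unique probability measure $\mu$ on the Borel $\sigma$-algebra of $A^\omega$ (product topology, $A$ discrete) with $\mu(\{s\in A^\omega: s_i=a_i,\ 1\le i\le n\})=\mathrm{card}(A)^{-n}$ for all $n\ge1$ and $a_1,\dots,a_n\in A$. *)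

(* Defs.v *)
From HB Require Import structures.
From mathcomp Require Import all_boot all_order all_algebra.
From mathcomp Require Import all_classical all_reals all_analysis.

Set Implicit Arguments.
Unset Strict Implicit.
Unset Printing Implicit Defensive.

Import Order.TTheory GRing.Theory Num.Theory.

Local Open Scope classical_set_scope.
Local Open Scope ring_scope.

(* The word x_1 x_2 x_3 ... is x 0, x 1, x 2, ...: indices are shifted by 1. *)
Definition infword (A : Type) : Type := nat -> A.

Definition alph (A : finType) (x : infword A) : {set A} :=
  [set a | `[< exists i, x i = a >]]%SET.

Definition Factp (A : finType) (x : infword A) : set (seq A) :=
  [set u | u != [::] /\
           exists m, u = mkseq (fun j => x (m + j)%N) (size u)].

(* x = U 0 ++ U 1 ++ U 2 ++ ...: since all the U i are non-empty, this holds
   exactly when every finite concatenation U 0 ++ ... ++ U n.-1 is a prefix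
   of x. *)
Definition is_factorization (A : finType) (x : infword A)
    (U : nat -> seq A) : Prop :=
  (forall i, U i != [::]) /\
  (forall n, let u := flatten (mkseq U n) in u = mkseq x (size u)).

(* The blocks of a factorization of x are factors of x, so quantifying over
   sequences in Factp x in the next definition loses no factorization. *)
Lemma factorization_Factp (A : finType) (x : infword A) (U : nat -> seq A) :
  is_factorization x U -> forall i, U i \in Factp x.
Proof.
move=> [Un0 Ux] i; apply/mem_set; split; first exact: Un0.
exists (size (flatten (mkseq U i))).
have := Ux i.+1; cbv zeta; rewrite mkseqS flatten_rcons size_cat.
move/(congr1 (drop (size (flatten (mkseq U i))))).
rewrite drop_size_cat // [in RHS]/mkseq -map_drop drop_iota add0n addnC addnK.
by move=> {1}->; rewrite /mkseq -[X in iota X _]addn0 iotaDl -map_comp.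
Qed.

Definition in_P (k : nat) (A : finType) (x : infword A) : Prop :=
  exists (C : finType) (c : Factp x -> C), #|C| = k /\
    forall U : nat -> Factp x,
      is_factorization x (fun i => set_val (U i)) ->
      exists i j, c (U i) <> c (U j).

(* The non-emptiness of A is an argument because a measurable type has to be
   pointed. The choice of the point is irrelevant. *)
Definition word_space (A : finType) (hA : (0 < #|A|)%N) : Type :=
  prod_topology (fun _ : nat => discrete_topology A).

HB.instance Definition _ (A : finType) (hA : (0 < #|A|)%N) :=
  Topological.copy (word_space hA)
    (prod_topology (fun _ : nat => discrete_topology A)).
HB.instance Definition _ (A : finType) (hA : (0 < #|A|)%N) :=
  isPointed.Build (word_space hA) (fun=> enum_val (Ordinal hA)).

Definition borel_words (A : finType) (hA : (0 < #|A|)%N) :=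
  g_sigma_algebraType (@open (word_space hA)).
HB.instance Definition _ (A : finType) (hA : (0 < #|A|)%N) :=
  Measurable.on (borel_words hA).

(* These values determine mu: the cylinders are stable under intersection (up
   to the empty set) and generate the Borel sigma-algebra. *)
Definition standard_bernoulli (R : realType) (A : finType)
    (hA : (0 < #|A|)%N) (mu : probability (borel_words hA) R) : Prop :=
  forall (n : nat) (a : 'I_n -> A), (0 < n)%N ->
    mu [set s : infword A | forall i : 'I_n, s i = a i]
      = ((#|A|%:R : R) ^- n)%:E.

(* Main.v *)
(* Colour a factor of x according to whether it is a prefix of x. In a
   monochromatic factorization the first block, hence every block, is then a
   prefix of x. This is impossible as soon as x contains arbitrarily long runs
   of some letter b distinct from its first letter: no block starts with b, so
   the first run of length n lies inside the first block, for every n. Almost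
   every word contains arbitrarily long runs of every letter, because the words
   avoiding the run b^n in each of m consecutive windows of length n have
   measure (1 - card(A)^-n)^m. *)

Require Import Defs.
From mathcomp Require Import all_boot all_order all_algebra.
From mathcomp Require Import all_classical all_reals all_analysis.
From mathcomp Require Import zify.

Import Order.TTheory GRing.Theory Num.Theory.

Local Open Scope classical_set_scope.
Local Open Scope ring_scope.

Lemma nth_factorization {A : finType} (x : infword A) (U : nat -> seq A) a0 :
  is_factorization x U -> forall i k, (k < size (U i))%N ->
  nth a0 (U i) k = x (size (flatten (mkseq U i)) + k)%N.
Proof.
move=> [_ Ux] i k ki; have := Ux i.+1; cbv zeta.
rewrite mkseqS flatten_rcons size_cat.
move/(congr1 (fun s => nth a0 s (size (flatten (mkseq U i)) + k))).
by rewrite nth_cat ltnNge leq_addr /= addKn nth_mkseq // ltn_add2l.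
Qed.

Lemma nth_prefix_factorization {A : finType} (x : infword A) (U : nat -> seq A) :
  is_factorization x U -> (forall i, U i = mkseq x (size (U i))) ->
  forall i k, (k < size (U i))%N ->
  x (size (flatten (mkseq U i)) + k)%N = x k.
Proof.
move=> Ufac Upre i k ki.
by rewrite -(nth_factorization _ _ (x 0%N) Ufac) // Upre nth_mkseq.
Qed.

(* The run of b's lies inside one block, and that block must be U 0: a later
   block, being a prefix of x, would exhibit an earlier run. *)
Lemma long_runs_no_prefix_factorization {A : finType} (x : infword A) (b : A)
    (U : nat -> seq A) :
  b != x 0%N ->
  (forall n, exists p, forall i, (i < n)%N -> x (p + i)%N = b) ->
  is_factorization x U -> ~ (forall i, U i = mkseq x (size (U i))).
Proof.
move=> bx0 runs Ufac Upre.
have Ux := nth_prefix_factorization _ _ Ufac Upre.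
set o := fun i => size (flatten (mkseq U i)).
have o0 : o 0%N = 0%N by [].
have oS i : o i.+1 = (o i + size (U i))%N.
  by rewrite /o mkseqS flatten_rcons size_cat.
have U_gt0 i : (0 < size (U i))%N by rewrite lt0n size_eq0 (proj1 Ufac).
have o_start i : x (o i) = x 0%N by rewrite -(Ux i 0%N) ?addn0.
(* One letter more than [U 0] can hold, so a run of this length inside [U 0] is absurd. *)
set n := (size (U 0%N)).+1.
have exP : exists p, `[< forall i, (i < n)%N -> x (p + i)%N = b >].
  by have [p Pp] := runs n; exists p; apply/asboolP.
have [p /asboolP Pp pmin] := ex_minnP exP.
have [i /andP[oip poi]] : exists i, (o i <= p < o i.+1)%N.
  have leo j : (j <= o j)%N.
    by elim: j => // j IH; rewrite oS -addn1 leq_add // U_gt0.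
  have [[|i] pj jmin] := ex_minnP (ex_intro (fun j => p < o j)%N p.+1 (leo p.+1)).
    by rewrite o0 in pj.
  by exists i; rewrite pj andbT leqNgt; apply/negP => /jmin; rewrite ltnn.
(* The run starting in block [i] cannot cross into the next block, whose first letter is [x 0], not
   [b]. *)
have pn : (p + n <= o i.+1)%N.
  rewrite leqNgt; apply/negP => lt_pn.
  have xb : x (p + (o i.+1 - p))%N = b by apply: Pp; lia.
  by move: bx0; rewrite -xb subnKC ?o_start ?eqxx // ltnW.
(* Block [i] copies the beginning of [x], so the run recurs [o i] places earlier. Minimality of [p]
   then forces [o i = 0], that is, [i = 0]. *)
have : (p <= p - o i)%N.
  apply: pmin; apply/asboolP => k kn; rewrite -(Pp k kn).
  rewrite -(Ux i); first by congr (x _); rewrite -/(o i); lia.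
  by rewrite oS in pn; lia.
case: i => [|i] in oip poi pn *; first by rewrite oS o0 in pn; lia.
by have := U_gt0 i; rewrite oS in oip *; lia.
Qed.

Lemma long_runs_in_P2 {A : finType} (x : infword A) (b : A) :
  b != x 0%N ->
  (forall n, exists p, forall i, (i < n)%N -> x (p + i)%N = b) -> in_P 2 x.
Proof.
move=> bx0 runs; exists bool.
exists (fun u => set_val u == mkseq x (size (set_val u))).
split; first by rewrite card_bool.
move=> U Ufac; apply: contrapT => cst.
apply: (long_runs_no_prefix_factorization _ _ _ bx0 runs Ufac) => i; apply/eqP.
have cE : (set_val (U i) == mkseq x (size (set_val (U i)))) =
          (set_val (U 0%N) == mkseq x (size (set_val (U 0%N)))).
  by apply: contrapT => ne; apply: cst; exists i, 0%N.
(* All blocks share the colour of [U 0], which is a prefix by the factorization condition for one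
   block. *)
rewrite cE; have /= := proj2 Ufac 1%N.
by rewrite cats0 => <-.
Qed.

Lemma measurable_cylinder {A : finType} (hA : (0 < #|A|)%N) (n : nat)
    (a : 'I_n -> A) :
  measurable ([set s : infword A | forall i : 'I_n, s i = a i] :
    set (borel_words hA)).
Proof.
have -> : [set s : infword A | forall i : 'I_n, s i = a i] =
    \bigcap_(i in [set: 'I_n]) [set s : infword A | s i = a i].
  by apply/seteqP; split => s /= sa i; [move=> _|]; exact: sa.
apply: (@fin_bigcap_measurable _ (borel_words hA)) => // i _.
apply: sub_sigma_algebra.
rewrite -[X in open X]/(@proj nat (fun=> discrete_topology A) i @^-1` [set a i]).
apply: open_comp; last exact: discrete_open.
by move=> s _; exact: (@proj_continuous nat (fun=> discrete_topology A)).
Qed.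

Lemma measure_bigsetU_le {d} {T : measurableType d} {R : realType}
    (mu : {measure set T -> \bar R}) (I : Type) (r : seq I) (P : pred I)
    (F : I -> set T) :
  (forall i, P i -> measurable (F i)) ->
  (mu (\big[setU/set0]_(i <- r | P i) F i) <= \sum_(i <- r | P i) mu (F i))%E.
Proof.
move=> mF; elim: r => [|i r IH]; first by rewrite !big_nil measure0.
rewrite !big_cons; case: ifP => // Pi.
apply: le_trans (leeD2l _ IH).
by apply: measureU2; [exact: mF|exact: bigsetU_measurable].
Qed.

(** The intersection of the [B m] covers [N], and its measure is at most every [z ^+ m], hence at
    most their limit 0. *)
Lemma negligible_le_expr {d} {T : measurableType d} {R : realType}
    (mu : {measure set T -> \bar R}) (N : set T) (z : R)
    (B : nat -> set T) : 0 <= z < 1 ->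
  (forall m, measurable (B m)) -> (forall m, N `<=` B m) ->
  (forall m, (mu (B m) <= (z ^+ m)%:E)%E) -> mu.-negligible N.
Proof.
move=> /andP[z0 z1] mB NB muB; exists (\bigcap_m B m); split.
- exact: bigcapT_measurable.
- apply/eqP; rewrite eq_le measure_ge0 andbT.
  have cz : (z ^+ m)%:E @[m --> \oo] --> 0%E.
    by apply: cvg_EFin; [exact: nearW|apply: cvg_expr; rewrite ger0_norm].
  rewrite -[leRHS](cvg_lim _ cz) //; apply: lime_ge; first exact: cvgP cz.
  apply: nearW => m; apply: le_trans (muB m); apply: le_measure; rewrite ?inE //.
  + exact: bigcapT_measurable.
  + exact: bigcap_inf.
- by move=> s Ns m _; exact: NB.
Qed.

Lemma negligible_no_run {R : realType} {A : finType} {hA : (0 < #|A|)%N}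
    {mu : probability (borel_words hA) R} (hmu : standard_bernoulli mu)
    (b : A) (n : nat) :
  mu.-negligible
    [set x : infword A | ~ exists p, forall i, (i < n)%N -> x (p + i)%N = b].
Proof.
case: n => [|n].
  by apply: (negligibleS _ (@negligible_set0 _ _ _ mu)) => x; apply; exists 0%N.
set q := #|A|; have qn_gt0 : (0 < q ^ n.+1)%N by rewrite expn_gt0 hA.
(* The possible contents of the first [m.+1] windows when none of them is the constant word on [b].
   Taking [m.+1] windows keeps the cylinder length positive, as [hmu] requires. *)
pose avoid m : {pred {ffun 'I_m.+1 -> {ffun 'I_n.+1 -> A}}} :=
  ffun_on (predC1 [ffun=> b]).
(* Position [i] is offset [i %% n.+1] in window [i %/ n.+1]. *)
pose cyl m (f : {ffun 'I_m.+1 -> {ffun 'I_n.+1 -> A}}) : set (borel_words hA) :=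
  [set s : infword A | forall i : 'I_(m.+1 * n.+1),
     s i = f (inord (i %/ n.+1)) (inord (i %% n.+1))].
have mcyl m f : measurable (cyl m f) by exact: measurable_cylinder.
(* The proportion of words of length [n.+1] that are not constantly [b]. *)
pose z : R := (q ^ n.+1).-1%:R / (q ^ n.+1)%:R.
have z01 : 0 <= z < 1.
  by rewrite divr_ge0 //= ltr_pdivrMr ?ltr0n // mul1r ltr_nat prednK.
apply: (@negligible_le_expr _ _ _ mu _ z
  (fun m => \big[setU/set0]_(f | f \in avoid m) cyl m f)) => //.
- by move=> m; apply: bigsetU_measurable.
- move=> m x nrun; rewrite -bigcup_pred.
  exists [ffun j : 'I_m.+1 => [ffun i : 'I_n.+1 => x (j * n.+1 + i)%N]] => /=.
    apply/ffun_onP => j; rewrite ffunE inE; apply/eqP => /ffunP run; apply: nrun.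
    exists (j * n.+1)%N => i ltin.
    by have := run (Ordinal ltin); rewrite !ffunE.
  move=> i; rewrite !ffunE !inordK ?ltn_mod ?ltn_divLR ?ltn_ord //.
  by rewrite -divn_eq.
(* Subadditivity suffices: there are [(q ^ n.+1).-1 ^ m.+1] cylinders of equal measure, and the sum
   of their measures is [z ^+ m.+1], at most [z ^+ m]. *)
- move=> m; apply: le_trans (measure_bigsetU_le mu _ _ _ _ _) _ => //.
  rewrite (eq_bigr (fun=> ((q%:R : R) ^- (m.+1 * n.+1))%:E)); last first.
    by move=> f _; apply: hmu; rewrite muln_gt0.
  rewrite sumEFin lee_fin sumr_const card_ffun_on cardC1 card_ffun !card_ord.
  rewrite [leLHS](_ : _ = z ^+ m.+1).
    by case/andP: z01 => z0 /ltW z1; apply: ler_wiXn2l.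
  by rewrite -[LHS]mulr_natl expr_div_n -!natrX (mulnC m.+1) expnM.
Qed.

Theorem corollary3p6 (R : realType) (A : finType) (hA : (0 < #|A|)%N)
    (mu : probability (borel_words hA) R) (hmu : standard_bernoulli mu) :
  mu.-negligible [set x : infword A | (1 < #|alph x|)%N /\ ~ in_P 2 x].
Proof.
pose N (b : A) : set (borel_words hA) := \bigcup_n
  [set x : infword A | ~ exists p, forall i, (i < n)%N -> x (p + i)%N = b].
have NN b : mu.-negligible (N b).
  by apply: negligible_bigcup => n; exact: negligible_no_run.
(* The letter [b] distinct from [x 0] depends on [x], so the exceptional sets of all letters are
   united. *)
apply: (@negligibleS _ _ _ _ (\big[setU/set0]_(b : A) N b)); last first.
  by elim/big_ind: _ => [||b _]; [exact: negligible_set0|exact: negligibleU|].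
move=> x [/card_gt1P[a [a' [_ _ aa']]] xP].
have [b bx0] : exists b, b != x 0%N.
  by have [ax|] := eqVneq a (x 0%N); [exists a'; rewrite -ax eq_sym|exists a].
rewrite -bigcup_seq; exists b; first by rewrite /= mem_index_enum.
apply: contrapT => xN; apply: xP; apply: (long_runs_in_P2 _ _ bx0) => n.
by apply: contrapT => nrun; apply: xN; exists n.
Qed.
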